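(* Let $n\ge2$. A linear map $\phi:\mathbf{RS}_n\to\mathbf{RS}_n$ preserves the spectrum, that is, $$\operatorname{spec}(\phi(A))=\operatorname{spec}(A)\qquad\text{for all }A\in\mathbf{RS}_n,$$ if and only if $\phi$ has one of the following forms: (1) when $n=2$: $\phi(A)=A_{\mathbf{DS}}+cA_R$ for all $A\in\mathbf{RS}_2$, for a constant $c\in[-1,1]$; (2) when $n\ge3$: there is a permutation matrix $P\in\mathbf{P}_n$ such that $\phi(A)=PAP^{-1}$ for all $A\in\mathbf{RS}_n$.
   Context: $\mathbf{P}_n$ is the set of $n\times n$ permutation matrices. $\mathbf{DS}_n$ (resp. $\mathbf{RS}_n$) is the set of $n\times n$ doubly stochastic (resp. row stochastic) matrices: real, entrywise nonnegative, with all row sums and column sums (resp. all row sums) equal to $1$. $\langle\cdot\rangle$ denotes the real linear span. Let $e=(1,\ldots,1)^t\in\mathbb{R}^n$ and $R_n=\{ev^t: v\in\mathbb{R}^n,\ v^te=0\}$. One has the vector space direct sum $\langle\mathbf{RS}_n\rangle=\langle\mathbf{DS}_n\rangle\oplus R_n$, and for $A\in\langle\mathbf{RS}_n\rangle$ we write $A=A_{\mathbf{DS}}+A_R$ with $A_{\mathbf{DS}}\in\langle\mathbf{DS}_n\rangle$ and $A_R\in R_n$; explicitly, $A_R=er^t$ where $r_i=\frac1n\sum_{k}a_{ki}-\frac1{n^2}\sum_{k,l}a_{kl}$ and $A_{\mathbf{DS}}=A-A_R$. A function $\phi:S\to T$ between subsets of real vector spaces is called linear if it can be extended to an $\mathbb{R}$-linear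 map from the span of $S$ to the span of $T$. $\operatorname{spec}(A)$ is the spectrum (multiset of complex eigenvalues) counting multiplicities. *)

(* Defs.v *)
From HB Require Import structures.
From mathcomp Require Import all_boot all_order all_algebra finmap multiset.
From mathcomp Require Import mathcomp_extra boolp classical_sets functions.
From mathcomp Require Import reals complex.

Set Implicit Arguments.
Unset Strict Implicit.
Unset Printing Implicit Defensive.

Import Order.TTheory GRing.Theory Num.Theory.
Local Open Scope classical_set_scope.
Local Open Scope ring_scope.

Definition RS (R : realType) (n : nat) : set 'M[R]_n :=
  [set A | (forall i j, 0 <= A i j) /\ (forall i, \sum_j A i j = 1)].

Definition DS (R : realType) (n : nat) : set 'M[R]_n :=
  [set A | [/\ forall i j, 0 <= A i j, forall i, \sum_j A i j = 1
             & forall j, \sum_i A i j = 1]].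

Definition evec (R : realType) (n : nat) : 'cV[R]_n := const_mx 1.

Definition Rspace (R : realType) (n : nat) : set 'M[R]_n :=
  [set A | exists2 v : 'cV[R]_n, v^T *m evec R n = 0 & A = evec R n *m v^T].

Definition lin_span (R : realType) (V : lmodType R) (S : set V) : set V :=
  [set x | exists k (a : 'I_k -> R) (v : 'I_k -> V),
     (forall i, S (v i)) /\ x = \sum_i a i *: v i].

(* [f] is a total function on the ambient space, but only its values on
   [lin_span S] are constrained: it stands for a linear map from the span of
   [S] to the span of [T] *)
Definition linear_on_sets (R : realType) (V W : lmodType R)
    (S : set V) (T : set W) (phi : S -> T) : Prop :=
  exists f : V -> W,
    [/\ set_fun (lin_span S) (lin_span T) f,
        forall (a : R) (x y : V), lin_span S x -> lin_span S y ->
          f (a *: x + y) = a *: f x + f y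
      & forall x : S, f (val x) = val (phi x)].

(* the multiset of roots, in R[i], of the characteristic polynomial *)
Definition spec (R : realType) (n : nat) (A : 'M[R]_n) : {mset R[i]}%mset :=
  seq_mset (sval (closed_field_poly_normal
                    (char_poly (map_mx (real_complex R) A)))).

Definition Rvec (R : realType) (n : nat) (A : 'M[R]_n) : 'cV[R]_n :=
  \col_i (n%:R^-1 * (\sum_k A k i) - (n%:R ^+ 2)^-1 * (\sum_k \sum_l A k l)).

Definition Rpart (R : realType) (n : nat) (A : 'M[R]_n) : 'M[R]_n :=
  evec R n *m (Rvec A)^T.

Definition DSpart (R : realType) (n : nat) (A : 'M[R]_n) : 'M[R]_n :=
  A - Rpart A.

Lemma evec_mulE (R : realType) n (v : 'cV[R]_n) i j :
  (evec R n *m v^T) i j = v j 0.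
Proof. by rewrite mxE big_ord1 !mxE mul1r. Qed.

Lemma spec_char_poly (R : realType) n (A : 'M[R]_n) :
  char_poly (map_mx (real_complex R) A) = \prod_(z <- spec A) ('X - z%:P).
Proof.
rewrite (perm_big _ (perm_eq_seq_mset _)) /=.
case: closed_field_poly_normal => r /= {1}->.
by rewrite (monicP (char_poly_monic _)) scale1r.
Qed.

Lemma lin_span_RS_rows (R : realType) n (A : 'M[R]_n) :
  lin_span (@RS R n) A -> exists s, forall i, \sum_j A i j = s.
Proof.
move=> [k [a [v [vRS ->]]]]; exists (\sum_i a i) => i.
under eq_bigr do rewrite summxE.
rewrite exchange_big; apply: eq_bigr => l _ /=.
under eq_bigr do rewrite mxE.
by rewrite -mulr_sumr (proj2 (vRS l)) mulr1.
Qed.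

Lemma lin_span_DS_rows_cols (R : realType) n (A : 'M[R]_n) :
  lin_span (@DS R n) A ->
  exists s, (forall i, \sum_j A i j = s) /\ (forall j, \sum_i A i j = s).
Proof.
move=> [k [a [v [vDS ->]]]]; exists (\sum_i a i); split=> i;
  under eq_bigr do rewrite summxE;
  rewrite exchange_big; apply: eq_bigr => l _ /=;
  under eq_bigr do rewrite mxE;
  by rewrite -mulr_sumr; case: (vDS l) => _ h1 h2; rewrite ?h1 ?h2 mulr1.
Qed.

Lemma rows_cols_lin_span_DS (R : realType) n (A : 'M[R]_n) s : (0 < n)%N ->
  (forall i, \sum_j A i j = s) -> (forall j, \sum_i A i j = s) ->
  lin_span (@DS R n) A.
Proof.
move=> n0 Ar Ac.
have n0' : 0 < n%:R :> R by rewrite ltr0n.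
pose m := \sum_i \sum_j `|A i j| + `|s| + 1.
have Am i j : - A i j <= m.
  rewrite (le_trans (ler_norm _)) // normrN /m (bigD1 i) //= (bigD1 j) //=.
  rewrite -!addrA lerDl !addr_ge0 ?sumr_ge0 // => k _; exact: sumr_ge0.
have m1 : `|s| + 1 <= m by rewrite /m -addrA lerDr sumr_ge0 // => k _; exact: sumr_ge0.
have m0 : 0 < m by apply: lt_le_trans m1; rewrite ltr_wpDl.
have t0 : 0 < s + m * n%:R.
  apply: (@lt_le_trans _ _ (s + m)); last first.
    by rewrite lerD2l ler_peMr ?(ltW m0) // ler1n.
  apply: (@lt_le_trans _ _ (s + (`|s| + 1))); last by rewrite lerD2l.
  by rewrite addrA ltr_wpDl // -lerBlDl sub0r -normrN ler_norm.
pose t := s + m * n%:R.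
pose J : 'M[R]_n := const_mx n%:R^-1.
pose B := t^-1 *: (A + m *: const_mx 1).
exists 2, (fun i : 'I_2 => if i == 0 then t else - (m * n%:R)),
  (fun i => if i == 0 then B else J); split=> [i|].
  have sumc (c : R) : \sum_(k < n) c = c * n%:R.
    by rewrite sumr_const card_ord mulr_natr.
  case: ifP => _; split=> [k l|k|k].
  - by rewrite !mxE mulr_ge0 ?invr_ge0 ?(ltW t0) // mulr1 -lerBlDl sub0r.
  - under eq_bigr do rewrite !mxE mulr1.
    by rewrite -mulr_sumr big_split /= Ar sumc mulVf ?gt_eqF.
  - under eq_bigr do rewrite !mxE mulr1.
    by rewrite -mulr_sumr big_split /= Ac sumc mulVf ?gt_eqF.
  - by rewrite mxE invr_ge0 ltW.
  - by under eq_bigr do rewrite mxE; rewrite sumc mulVf ?gt_eqF.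
  - by under eq_bigr do rewrite mxE; rewrite sumc mulVf ?gt_eqF.
rewrite !big_ord_recl big_ord0 addr0 /= scalerA mulfV ?gt_eqF // scale1r.
apply/matrixP => i j; rewrite !mxE mulr1 mulNr -mulrA mulfV ?gt_eqF //.
by rewrite mulr1 addrK.
Qed.

(* [DSpart] and [Rpart] are the components in the direct sum
   <RS> = <DS> (+) Rspace *)
Lemma RS_decomposition (R : realType) n (A : 'M[R]_n) : (0 < n)%N ->
  lin_span (@RS R n) A ->
  [/\ lin_span (@DS R n) (DSpart A), Rspace (Rpart A),
      A = DSpart A + Rpart A
    & forall D N : 'M[R]_n, lin_span (@DS R n) D -> Rspace N -> A = D + N ->
        D = DSpart A /\ N = Rpart A].
Proof.
move=> n0 /lin_span_RS_rows [s As].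
have n0' : n%:R != 0 :> R by rewrite pnatr_eq0 -lt0n.
have sumc (c : R) : \sum_(k < n) c = c * n%:R.
  by rewrite sumr_const card_ord mulr_natr.
have tot : \sum_k \sum_l A k l = s * n%:R.
  by under eq_bigr do rewrite As; rewrite sumc.
have rE i : Rvec A i 0 = n%:R^-1 * ((\sum_k A k i) - s).
  by rewrite mxE tot mulrBr expr2 invfM mulrACA [_^-1 * s]mulrC -[X in _ - X]mulrA mulVf // mulr1 mulrC.
have r0 : \sum_i Rvec A i 0 = 0.
  under eq_bigr do rewrite rE.
  by rewrite -mulr_sumr sumrB exchange_big /= tot sumc subrr mulr0.
have RP (v : 'cV[R]_n) : \sum_i v i 0 = 0 -> v^T *m evec R n = 0.
  move=> v0; apply/matrixP => i j; rewrite !mxE -[RHS]v0.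
  by apply: eq_bigr => k _; rewrite !mxE mulr1 ord1.
split.
- apply: (@rows_cols_lin_span_DS _ _ _ s) => // i.
    under eq_bigr do rewrite mxE [X in _ + X]mxE evec_mulE.
    by rewrite sumrB As r0 subr0.
  under eq_bigr do rewrite mxE [X in _ + X]mxE evec_mulE.
  rewrite sumrB sumc rE mulrAC mulVf // mul1r; apply/eqP.
  by rewrite subr_eq addrC subrK.
- by exists (Rvec A) => //; exact: RP.
- by rewrite subrK.
move=> D N /lin_span_DS_rows_cols [s' [Dr Dc]] [v v0 NE] AE.
have vs : \sum_i v i 0 = 0.
  transitivity ((v^T *m evec R n) 0 0); last by rewrite v0 mxE.
  rewrite mxE.
  by apply: eq_bigr => k _; rewrite !mxE mulr1.
have ss : s = s'.
  rewrite -(As (Ordinal n0)) -(Dr (Ordinal n0)) AE NE.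
  under eq_bigr do rewrite mxE evec_mulE.
  by rewrite big_split /= vs addr0.
have RN : Rpart A = N.
  rewrite NE; apply/matrixP => i j; rewrite !evec_mulE rE {1}AE NE.
  under eq_bigr do rewrite mxE evec_mulE.
  by rewrite big_split /= Dc sumc ss [s' + _]addrC addrK mulrC mulfK.
by split=> //; rewrite /DSpart RN AE addrK.
Qed.

(* Main.v *)
Require Import Defs.
From HB Require Import structures.
From mathcomp Require Import all_boot all_order all_algebra finmap multiset.
From mathcomp Require Import mathcomp_extra boolp classical_sets functions.
From mathcomp Require Import reals complex.
From mathcomp Require Import perm ring lra.

Set Implicit Arguments.
Unset Strict Implicit.
Unset Printing Implicit Defensive.

Import Order.TTheory GRing.Theory Num.Theory.
Local Open Scope classical_set_scope.
Local Open Scope ring_scope.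

(** Let [f] be the linear extension of a spectrum preserver and let
[L i j = E_ii - E_ij]. Every row stochastic [A] is [1 - \sum A_ij L_ij], so [f]
is determined by [f 1] and by the matrices [M i j = 1 - f (1 - L i j)], which
have nonnegative diagonal, nonpositive off-diagonal entries, and zero row sums.

The characteristic polynomial determines [\tr A] and [\tr (A ^ 2)]; polarising,
[\tr (f A * f B) = \tr (A * B)]. The trace gives [f 1 = 1], since the identity
is the only row stochastic matrix of trace [n], and [\tr (M i j) = 1] for
[i <> j]. It also shows that row stochastic matrices with zero diagonal are
preserved; two of them that differ in one row only show that the diagonal of
[M i j] does not depend on [j].

Let [n >= 3]. For [i <> k] choose [l] different from [i] and [k]; then
[0 = \tr (L i j * L k l) = \tr (M i j * M k l)], and the right-hand side is a
sum of nonnegative terms, among which are the products of diagonal entries. So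
the diagonals of [M i j] and [M k l] have disjoint supports, for every [l] since
the second one does not depend on [l]. As there are [n] such supports in [n]
places, none of them empty, each is one point [s i], and [s] is a permutation.
Hence [M i j] has the row [s i] only, with diagonal entry [1]. Finally
[1 = \tr (M i j * M j i)] is the product of an entry of each matrix, both in
[[-1, 0]], so [M i j] has [-1] at [(s i, s j)] and [M i j = L (s i) (s j)].
This says that [f] is conjugation by the permutation matrix of [s].

When [n = 2] there is no third index, and only the diagonal condition remains:
[M 0 1 + M 1 0 = L 0 1 + L 1 0] and [M 0 1] is a convex combination
of [L 0 1] and [L 1 0], which leaves one parameter [c] in [[-1, 1]]. Conversely,
the characteristic polynomial of a [2 * 2] row stochastic matrix depends only on
its trace, and [A_R] has trace zero. *)

(** * Spectrum and traces *)

(** The factorisation [X^2 - A^2 = (X - A)(X + A)] shows that the characteristic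
polynomial of [A] determines that of [A^2]; this gives access to [\tr (A^2)]
without eigenvalues. *)
Lemma char_poly_sqr (K : comNzRingType) n (A : 'M[K]_n) :
  char_poly (A *m A) \Po 'X^2
    = (-1) ^+ n * (char_poly A * (char_poly A \Po - 'X)).
Proof.
pose A' := map_mx polyC A.
have compA (q : {poly K}) : map_mx (comp_poly q) A' = A'.
  by apply/matrixP => i j; rewrite !mxE comp_polyC.
have charE (q : {poly K}) (B : 'M[K]_n) :
    char_poly B \Po q = \det (q%:M - map_mx polyC B).
  rewrite -[LHS](det_map_mx (comp_poly q)); congr (\det _).
  apply/matrixP => i j.
  by rewrite !mxE rmorphB rmorphMn /= comp_polyX comp_polyC.
rewrite !charE -[char_poly A]comp_polyXr charE.
have -> : (- 'X)%:M - A' = (-1) *: ('X%:M + A').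
  by rewrite scaleN1r opprD raddfN.
rewrite detZ mulrCA [X in _ = _ * X]mulrA -mulrCA mulrA -expr2 sqrr_sign mul1r.
rewrite -det_mulmx mulmxDr !mulmxBl -scalar_mxM map_mxM expr2 -/A'.
by rewrite scalar_mxC addrA subrK.
Qed.

Lemma char_poly_mxtrace (K : comNzRingType) n (A B : 'M[K]_n) :
  char_poly A = char_poly B -> \tr A = \tr B.
Proof.
case: n A B => [|n] A B AB; first by rewrite !thinmx0.
by apply: oppr_inj; rewrite -!char_poly_trace // AB.
Qed.

Lemma char_poly_mxtrace_sqr (K : comNzRingType) n (A B : 'M[K]_n) :
  char_poly A = char_poly B -> \tr (A *m A) = \tr (B *m B).
Proof.
move=> AB; apply: char_poly_mxtrace.
have : char_poly (A *m A) \Po 'X^2 = char_poly (B *m B) \Po 'X^2.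
  by rewrite !char_poly_sqr AB.
move=> eqX2; apply/polyP => i; move/(congr1 (fun p : {poly K} => p`_(i * 2))): eqX2.
by rewrite !coef_comp_poly_Xn // dvdn_mull // mulnK.
Qed.

Lemma char_poly_similar (K : comNzRingType) n (A P Q : 'M[K]_n) :
  P *m Q = 1%:M -> char_poly (P *m A *m Q) = char_poly A.
Proof.
move=> PQ; have PQ' := congr1 (map_mx polyC) PQ.
rewrite map_mxM map_scalar_mx /= in PQ'.
rewrite /char_poly; have -> : char_poly_mx (P *m A *m Q) =
    map_mx polyC P *m char_poly_mx A *m map_mx polyC Q.
  rewrite /char_poly_mx mulmxBr mulmxBl !map_mxM; congr (_ - _).
  by rewrite scalar_mxC -mulmxA PQ' mulmx1.
rewrite !det_mulmx mulrC mulrA -det_mulmx.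
by rewrite (mulmx1C PQ') det1 mul1r.
Qed.

Lemma spec_eq_char_poly (R : realType) n (A B : 'M[R]_n) :
  spec A = spec B <-> char_poly A = char_poly B.
Proof.
split=> [AB|AB]; last by rewrite /spec -!map_char_poly AB.
apply: (@map_poly_inj _ _ (real_complex R)).
by rewrite !map_char_poly; rewrite !spec_char_poly AB.
Qed.

(** * Row stochastic matrices *)

Definition fun_mx (R : realType) n (s : 'I_n -> 'I_n) : 'M[R]_n :=
  \matrix_(i, j) (s i == j)%:R.

Definition redirect n (i j : 'I_n) : 'I_n -> 'I_n :=
  fun k => if k == i then j else k.

Lemma RS_fun_mx (R : realType) n (s : 'I_n -> 'I_n) : RS (fun_mx R s).
Proof.
split=> [i j|i]; first by rewrite mxE ler0n.
rewrite (bigD1 (s i)) //= mxE eqxx big1 ?addr0 // => j /negPf ji.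
by rewrite mxE eq_sym ji.
Qed.

Lemma fun_mx_id (R : realType) n : fun_mx R (@id 'I_n) = 1%:M.
Proof. by apply/matrixP => i j; rewrite !mxE. Qed.

Lemma RS_conv (R : realType) n (A B : 'M[R]_n) :
  RS A -> RS B -> RS (2^-1 *: A + 2^-1 *: B).
Proof.
move=> [A0 A1] [B0 B1]; split=> [i j|i].
  by rewrite !mxE addr_ge0 // mulr_ge0 ?invr_ge0 ?ler0n.
under eq_bigr do rewrite !mxE.
rewrite big_split /= -!mulr_sumr A1 B1; lra.
Qed.

Lemma RS_le1 (R : realType) n (A : 'M[R]_n) i j : RS A -> A i j <= 1.
Proof.
by move=> [A0 A1]; rewrite -(A1 i) (bigD1 j) //= lerDl sumr_ge0.
Qed.

Lemma RS_mxtrace0 (R : realType) n (A : 'M[R]_n) i :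
  RS A -> \tr A = 0 -> A i i = 0.
Proof. by move=> [A0 _] /psumr_eq0P ->. Qed.

Lemma RS_mxtrace_max (R : realType) n (A : 'M[R]_n) :
  RS A -> \tr A = n%:R -> A = 1%:M.
Proof.
move=> rsA trA; have [A0 A1] := rsA.
have d1 i : A i i = 1.
  apply/eqP; rewrite eq_sym -subr_eq0; apply/eqP.
  apply: (psumr_eq0P (P := predT) (F := fun i => 1 - A i i)) => //.
    by move=> k _; rewrite subr_ge0 RS_le1.
  by rewrite sumrB sumr_const card_ord -/(mxtrace A) trA subrr.
apply/matrixP => i j; rewrite mxE; have [<-|ij] := eqVneq i j; first exact: d1.
have rest : \sum_(k | k != i) A i k = 0.
  by apply: (addrI 1); rewrite addr0 -[RHS](A1 i) [RHS](bigD1 i) //= d1.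
apply: (psumr_eq0P (P := fun k => k != i) _ rest); last by rewrite eq_sym.
by move=> k _; exact: A0.
Qed.

(** The form in which linearity on the span is used: it mentions only values of
[f] at row stochastic matrices. *)
Definition RS_linear (R : realType) n (f : 'M[R]_n -> 'M[R]_n) : Prop :=
  forall (I : finType) (a : I -> R) (v : I -> 'M[R]_n),
    (forall i, RS (v i)) -> f (\sum_i a i *: v i) = \sum_i a i *: f (v i).

Lemma linear_on_sets_RS (R : realType) n (phi : @RS R n -> @RS R n) :
  linear_on_sets phi ->
  exists2 f, RS_linear f & forall A : @RS R n, f (val A) = val (phi A).
Proof.
move=> [f [_ f_lin f_phi]]; exists f => // I a v RSv.
have span0 : lin_span (@RS R n) 0.
  by exists 0%N, (fun=> 0), (fun=> 0); split=> [[]//|]; rewrite big_ord0.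
have span1 i : lin_span (@RS R n) (v i).
  by exists 1%N, (fun=> 1), (fun=> v i); rewrite big_ord1 scale1r.
have f0 : f 0 = 0.
  by have := f_lin (-1) 0 0 span0 span0; rewrite !scaleN1r oppr0 addr0 addNr.
have f_sum k (w : 'I_k -> I) :
    f (\sum_j a (w j) *: v (w j)) = \sum_j a (w j) *: f (v (w j)).
  elim: k w => [|k IH] w; first by rewrite !big_ord0.
  rewrite !big_ord_recl f_lin ?IH //.
  by exists k, (fun j => a (w (lift ord0 j))), (fun j => v (w (lift ord0 j))).
have enumE (F : I -> 'M[R]_n) :
    \sum_i F i = \sum_(j < #|predT : pred I|) F (enum_val j).
  by rewrite -(big_enum_val F); apply: eq_bigl.
by rewrite !enumE f_sum.
Qed.

Lemma RS_linear2 (R : realType) n (f : 'M[R]_n -> 'M[R]_n) a b A B :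
  RS_linear f -> RS A -> RS B -> f (a *: A + b *: B) = a *: f A + b *: f B.
Proof.
move=> f_lin RSA RSB.
have := f_lin bool (fun t => if t then a else b) (fun t => if t then A else B).
by rewrite !big_bool /=; apply; case.
Qed.

(** * Invariants of a spectrum preserver *)

(** The hypothesis on the spectrum is stated over the real field, which avoids
complex eigenvalues. *)
Definition spectrum_preserver (R : realType) n (f : 'M[R]_n -> 'M[R]_n) : Prop :=
  [/\ RS_linear f, forall A, RS A -> RS (f A)
    & forall A, RS A -> char_poly (f A) = char_poly A].

Lemma preserver_mxtrace (R : realType) n (f : 'M[R]_n -> 'M[R]_n) A :
  spectrum_preserver f -> RS A -> \tr (f A) = \tr A.
Proof. by move=> [_ _ fC] RSA; apply: char_poly_mxtrace; exact: fC. Qed.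

Lemma preserver1 (R : realType) n (f : 'M[R]_n -> 'M[R]_n) :
  spectrum_preserver f -> f 1%:M = 1%:M.
Proof.
move=> fP; have [_ fRS _] := fP; have RS1 := RS_fun_mx R (@id 'I_n).
rewrite fun_mx_id in RS1.
by apply: RS_mxtrace_max; [exact: fRS|rewrite preserver_mxtrace ?mxtrace1].
Qed.

(** Polarisation of the invariance of [\tr (A^2)], at the midpoint of [A] and
[B], which is again row stochastic. *)
Lemma preserver_mxtraceM (R : realType) n (f : 'M[R]_n -> 'M[R]_n) A B :
  spectrum_preserver f -> RS A -> RS B -> \tr (f A *m f B) = \tr (A *m B).
Proof.
move=> [f_lin fRS fC] RSA RSB.
have sqr C : RS C -> \tr (f C *m f C) = \tr (C *m C).
  by move=> RSC; apply: char_poly_mxtrace_sqr; exact: fC.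
have := sqr _ (RS_conv RSA RSB).
have expand (C D : 'M[R]_n) :
    \tr ((2^-1 *: C + 2^-1 *: D) *m (2^-1 *: C + 2^-1 *: D)) =
    4^-1 * (\tr (C *m C) + 2 * \tr (C *m D) + \tr (D *m D)).
  rewrite mulmxDl !mulmxDr -!scalemxAl -!scalemxAr !mxtraceD !mxtraceZ.
  by rewrite (mxtrace_mulC D C); field.
by rewrite RS_linear2 // !expand (sqr A) // (sqr B) //; lra.
Qed.

(** This is [E_ii - E_ij], the Laplacian of the single arc from [i] to [j]; it
vanishes when [i = j]. *)
Definition arc_mx (R : realType) n (i j : 'I_n) : 'M[R]_n :=
  1%:M - fun_mx R (redirect i j).

(** The value of [f] at [arc_mx R i j] when [f 1 = 1], but written through a row
stochastic matrix so that sign information is available. For [f = id] it is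
convertible to [arc_mx R i j]. *)
Definition arc_image (R : realType) n (f : 'M[R]_n -> 'M[R]_n) (i j : 'I_n) :=
  1%:M - f (fun_mx R (redirect i j)).

Lemma arc_mxE (R : realType) n (i j k l : 'I_n) :
  arc_mx R i j k l = (k == i)%:R * ((l == i)%:R - (l == j)%:R).
Proof.
rewrite !mxE /redirect; have [->|ki] := eqVneq k i; last by rewrite mul0r subrr.
by rewrite mul1r ![_ == l]eq_sym.
Qed.

Lemma arc_mx_delta (R : realType) n (i j : 'I_n) :
  arc_mx R i j = delta_mx i i - delta_mx i j.
Proof.
apply/matrixP => k l; rewrite arc_mxE !mxE.
by case: eqP; rewrite /= ?mul1r ?mul0r ?subrr.
Qed.

Lemma arc_imageii (R : realType) n (f : 'M[R]_n -> 'M[R]_n) i :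
  f 1%:M = 1%:M -> arc_image f i i = 0.
Proof.
move=> f1; rewrite /arc_image; have -> : fun_mx R (redirect i i) = 1%:M.
  apply/matrixP => k l; rewrite !mxE /redirect.
  by case: (eqVneq k i) => [->|].
by rewrite f1 subrr.
Qed.

(** In the span, [A + (n - 1) 1 = \sum_ij A_ij (1 - arc_mx i j)], a relation
between row stochastic matrices only, to which linearity applies. *)
Lemma arc_image_expand (R : realType) n (f : 'M[R]_n -> 'M[R]_n) A :
  RS_linear f -> f 1%:M = 1%:M -> RS A ->
  f A = 1%:M - \sum_i \sum_j A i j *: arc_image f i j.
Proof.
move=> f_lin f1 RSA; have [_ A1] := RSA.
pose N (p : 'I_n * 'I_n) := fun_mx R (redirect p.1 p.2).
have sum1 (B : 'M[R]_n) : \sum_i \sum_j A i j *: B = n%:R *: B.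
  under eq_bigr do rewrite -scaler_suml A1 scale1r.
  by rewrite sumr_const card_ord scaler_nat.
have AE : 1 *: A + (n%:R - 1) *: 1%:M = \sum_p A p.1 p.2 *: N p.
  rewrite -(pair_bigA _ (fun i j => A i j *: fun_mx R (redirect i j))) /=.
  transitivity (\sum_i \sum_j A i j *: (1%:M - arc_mx R i j)); last first.
    by apply: eq_bigr => i _; apply: eq_bigr => j _; rewrite /arc_mx subKr.
  under eq_bigr do under eq_bigr do rewrite scalerBr.
  under eq_bigr do rewrite sumrB.
  rewrite sumrB sum1 scalerBl addrC addrAC -addrA scale1r; congr (_ + _).
  have -> : \sum_i \sum_j A i j *: arc_mx R i j =
      \sum_i (\sum_j A i j *: delta_mx i i) - \sum_i \sum_j A i j *: delta_mx i j.
    rewrite -sumrB; apply: eq_bigr => i _; rewrite -sumrB.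
    by apply: eq_bigr => j _; rewrite arc_mx_delta scalerBr.
  rewrite -matrix_sum_delta opprB scale1r; congr (_ - _).
  under eq_bigr do rewrite -scaler_suml A1 scale1r.
  apply/matrixP => i j; rewrite summxE (bigD1 i) //= big1 ?addr0 => [|k ki].
    by rewrite !mxE eqxx eq_sym.
  by rewrite mxE eq_sym (negPf ki).
have := f_lin _ (fun p => A p.1 p.2) N (fun p => RS_fun_mx R _).
rewrite -AE RS_linear2 // ?f1; last by rewrite -fun_mx_id; exact: RS_fun_mx.
rewrite -(pair_bigA _ (fun i j => A i j *: f (fun_mx R (redirect i j)))) /=.
have -> : \sum_i \sum_j A i j *: f (fun_mx R (redirect i j)) =
    n%:R *: 1%:M - \sum_i \sum_j A i j *: arc_image f i j.
  rewrite -sum1 -sumrB; apply: eq_bigr => i _; rewrite -sumrB.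
  by apply: eq_bigr => j _; rewrite -scalerBr /arc_image subKr.
rewrite scale1r scalerBl scale1r => fE.
by apply: (addIr (n%:R *: 1%:M - 1%:M)); rewrite fE [RHS]addrC addrA subrK.
Qed.

Lemma arc_image_sum (R : realType) n (f : 'M[R]_n -> 'M[R]_n) i j k :
  spectrum_preserver f -> \sum_l arc_image f i j k l = 0.
Proof.
move=> [_ fRS _]; have [_ f1] := fRS _ (RS_fun_mx R (redirect i j)).
under eq_bigr do rewrite !mxE.
rewrite sumrB f1 (bigD1 k) //= eqxx big1 ?addr0 ?subrr // => l lk.
by rewrite eq_sym (negPf lk).
Qed.

Lemma arc_image_diag_ge0 (R : realType) n (f : 'M[R]_n -> 'M[R]_n) i j k :
  spectrum_preserver f -> 0 <= arc_image f i j k k.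
Proof.
move=> [_ fRS _]; rewrite !mxE eqxx subr_ge0.
by apply: RS_le1; apply: fRS; exact: RS_fun_mx.
Qed.

Lemma arc_image_offdiag (R : realType) n (f : 'M[R]_n -> 'M[R]_n) i j k l :
  spectrum_preserver f -> k != l -> -1 <= arc_image f i j k l <= 0.
Proof.
move=> [_ fRS _] kl; rewrite !mxE (negPf kl) sub0r lerN2 oppr_le0.
have RSf := fRS _ (RS_fun_mx R (redirect i j)).
by rewrite RS_le1 //; case: RSf => ->.
Qed.

Lemma mxtrace_arc_mx (R : realType) n (i j : 'I_n) :
  i != j -> \tr (arc_mx R i j) = 1.
Proof.
move=> ij; rewrite /mxtrace (bigD1 i) //= big1 => [|k /negPf ki].
  by rewrite arc_mxE eqxx (negPf ij) subr0 mulr1 addr0.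
by rewrite arc_mxE ki mul0r.
Qed.

Lemma mxtrace_arc_mxM (R : realType) n (i j k l : 'I_n) :
  i != k -> \tr (arc_mx R i j *m arc_mx R k l) = ((j == k) && (i == l))%:R.
Proof.
move=> /negPf ik; have tr_delta a b (B : 'M[R]_n) : \tr (delta_mx a b *m B) = B b a.
  rewrite /mxtrace (bigD1 a) //= big1 ?addr0 => [|c ca]; rewrite mxE.
    rewrite (bigD1 b) //= big1 ?addr0 => [|c cb]; rewrite mxE eqxx /=.
      by rewrite eqxx mul1r.
    by rewrite (negPf cb) mul0r.
  by apply: big1 => e _; rewrite mxE (negPf ca) mul0r.
rewrite (arc_mx_delta _ i j) mulmxBl raddfB /= !tr_delta !arc_mxE ik mul0r sub0r.
by rewrite sub0r mulrN opprK -natrM mulnb.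
Qed.

Lemma mxtrace_arc_image (R : realType) n (f : 'M[R]_n -> 'M[R]_n) i j :
  spectrum_preserver f -> i != j -> \tr (arc_image f i j) = 1.
Proof.
move=> fP ij; rewrite -(mxtrace_arc_mx R ij) !raddfB /=.
by rewrite (preserver_mxtrace fP) //; exact: RS_fun_mx.
Qed.

Lemma mxtrace_arc_imageM (R : realType) n (f : 'M[R]_n -> 'M[R]_n) i j k l :
  spectrum_preserver f ->
  \tr (arc_image f i j *m arc_image f k l) = \tr (arc_mx R i j *m arc_mx R k l).
Proof.
move=> fP; have RSN := RS_fun_mx R.
rewrite /arc_image /arc_mx !mulmxBl !mulmxBr !mulmx1 !mul1mx !raddfB /=.
by rewrite preserver_mxtraceM // !(preserver_mxtrace fP).
Qed.

(** A row stochastic matrix with zero trace has zero diagonal, and so has its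
image. Changing the target of the row [i] from [j] to [j'] in such a matrix
subtracts [arc_mx i j' - arc_mx i j]. *)
Lemma arc_image_diag_eq (R : realType) n (f : 'M[R]_n -> 'M[R]_n) i j j' k :
  spectrum_preserver f -> j != i -> j' != i ->
  arc_image f i j k k = arc_image f i j' k k.
Proof.
move=> fP ji ji'; have [f_lin fRS _] := fP.
(* The map sending [i] to [j] and all other points to [i] has no fixed point. *)
pose A j k := if k == i then j else i : 'I_n.
have RSN := RS_fun_mx R.
have fA0 h : h != i -> f (fun_mx R (A h)) k k = 0.
  move=> hi; apply: RS_mxtrace0; first exact/fRS/RSN.
  rewrite preserver_mxtrace //; apply: big1 => l _; rewrite mxE /A.
  by case: (eqVneq l i) => [->|li]; rewrite ?(negPf hi) // eq_sym (negPf li).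
have AE : 1 *: fun_mx R (A j) + 1 *: fun_mx R (redirect i j') =
          1 *: fun_mx R (A j') + 1 *: fun_mx R (redirect i j).
  apply/matrixP => a b; rewrite !scale1r !mxE /A /redirect.
  by case: ifP => _; rewrite // addrC.
have := congr1 f AE; rewrite !RS_linear2 // !scale1r.
move/matrixP/(_ k k); rewrite !mxE !fA0 // !add0r => ->.
by [].
Qed.

(** * Dimension at least three *)

Lemma third_index n (i k : 'I_n) : (3 <= n)%N -> exists l, (l != i) && (l != k).
Proof.
move=> n3; have := cardC (pred2 i k); rewrite card2 card_ord => cardE.
have /card_gt0P[l] : (0 < #|[predC pred2 i k]|)%N.
  rewrite -(ltn_add2l (i != k).+1) addn0 cardE.
  by apply: leq_trans n3; case: (i != k).
by rewrite !inE negb_or => li; exists l.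
Qed.

(** With [l'] outside [i] and [k], the matrices [arc_mx i j] and [arc_mx k l']
are orthogonal for the trace form when [i <> k]. The trace of the product of
their images is a sum of nonnegative terms, as entries at transposed places have
the same sign. Replacing [l] by [l'] does not change the diagonal. *)
Lemma arc_image_diag_disjoint (R : realType) n (f : 'M[R]_n -> 'M[R]_n)
    i j k l p : (3 <= n)%N ->
  spectrum_preserver f -> i != k -> j != i -> l != k ->
  arc_image f i j p p * arc_image f k l p p = 0.
Proof.
move=> n3 fP ik ji lk; have [l' /andP[li' lk']] := third_index i k n3.
rewrite (arc_image_diag_eq p fP lk lk').
have prod_ge0 q r : 0 <= arc_image f i j q r * arc_image f k l' r q.
  have [->|qr] := eqVneq q r; first by rewrite mulr_ge0 ?arc_image_diag_ge0.
  have /andP[_ Mqr] := arc_image_offdiag i j fP qr.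
  rewrite eq_sym in qr; have /andP[_ Mrq] := arc_image_offdiag k l' fP qr.
  by rewrite mulr_le0.
have : \tr (arc_image f i j *m arc_image f k l') = 0.
  rewrite mxtrace_arc_imageM // mxtrace_arc_mxM //.
  by rewrite [i == l']eq_sym (negPf li') andbF.
move=> /psumr_eq0P tr0; have row_p : (arc_image f i j *m arc_image f k l') p p = 0.
  by apply: tr0 => // q _; rewrite mxE; apply: sumr_ge0 => r _; exact: prod_ge0.
by rewrite mxE in row_p; exact: (psumr_eq0P (fun q _ => prod_ge0 p q) row_p).
Qed.

(** Each diagonal has sum [1], hence a nonzero entry, whose place determines
[i] by disjointness; an injection of ['I_n] into itself leaves no room for a
second nonzero entry. *)
Lemma arc_image_perm (R : realType) n (f : 'M[R]_n -> 'M[R]_n) : (3 <= n)%N ->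
  spectrum_preserver f ->
  exists s : {perm 'I_n}, forall i j p, i != j -> p != s i ->
    arc_image f i j p p = 0.
Proof.
move=> n3 fP; have nxt i : {j : 'I_n | j != i}.
  by apply: sigW; have [l /andP[li _]] := third_index i i n3; exists l.
have pivot i : {p | arc_image f i (sval (nxt i)) p p != 0}.
  apply: sigW; apply: contrapT => /forallNP diag0.
  have : \tr (arc_image f i (sval (nxt i))) = 1.
    by rewrite mxtrace_arc_image // eq_sym; exact: svalP (nxt i).
  rewrite /mxtrace big1 => [/eqP|p _]; first by rewrite eq_sym oner_eq0.
  by apply/eqP/negP => /negP; exact: diag0.
pose s i := sval (pivot i).
have s_diag0 i k j : i != k -> j != k -> arc_image f k j (s i) (s i) = 0.
  move=> ik jk.
  have /eqP := arc_image_diag_disjoint (s i) n3 fP ik (svalP (nxt i)) jk.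
  by rewrite mulf_eq0 (negPf (svalP (pivot i))) => /eqP.
have s_inj : injective s.
  move=> i k sik; apply/eqP/negPn/negP => ik.
  have := svalP (pivot k); rewrite -/(s k) -sik s_diag0 ?eqxx //.
  exact: svalP (nxt k).
exists (perm s_inj) => i j p ij ps; rewrite -[p](permKV (perm s_inj)) permE.
rewrite s_diag0 // 1?eq_sym //; apply: contraNneq ps => ->.
by rewrite permKV.
Qed.

(** A Laplacian with one nonzero diagonal entry has one nonzero row, so the trace
of the product of the images of opposite arcs reduces to a single product of
two entries. That product is [1], which forces both entries to be [-1]. *)
Lemma arc_image_arc (R : realType) n (f : 'M[R]_n -> 'M[R]_n) : (3 <= n)%N ->
  spectrum_preserver f ->
  exists s : {perm 'I_n}, forall i j, arc_image f i j = arc_mx R (s i) (s j).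
Proof.
move=> n3 fP; have [s s0] := arc_image_perm n3 fP.
exists s => i j; have [<-|ij] := eqVneq i j.
  rewrite arc_imageii; last exact: preserver1.
  by apply/matrixP => k l; rewrite arc_mxE subrr mulr0 mxE.
have row0 a b p q : a != b -> p != s a -> arc_image f a b p q = 0.
  move=> ab pa; have diag0 := s0 _ _ _ ab pa.
  have [<-//|pq] := eqVneq p q; apply: oppr_inj; rewrite oppr0.
  apply: (psumr_eq0P (P := predT) (F := fun q => - arc_image f a b p q)) => //.
    move=> r _; rewrite oppr_ge0; have [<-|pr] := eqVneq p r; first by rewrite diag0.
    by have /andP[] := arc_image_offdiag a b fP pr.
  by rewrite sumrN arc_image_sum ?oppr0.
have diag1 a b : a != b -> arc_image f a b (s a) (s a) = 1.
  move=> ab; rewrite -(mxtrace_arc_image fP ab) /mxtrace (bigD1 (s a)) //=.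
  by rewrite big1 ?addr0 // => p pa; exact: row0.
have ji : j != i by rewrite eq_sym.
have sij : s i != s j by rewrite (inj_eq perm_inj).
have sji : s j != s i by rewrite eq_sym.
have prod1 : arc_image f i j (s i) (s j) * arc_image f j i (s j) (s i) = 1.
  have := mxtrace_arc_imageM i j j i fP.
  rewrite mxtrace_arc_mxM // !eqxx => tr1.
  rewrite -[RHS]tr1 /mxtrace (bigD1 (s i)) //=.
  rewrite [X in _ + X]big1 ?addr0 => [|p pi]; last first.
    by rewrite mxE; apply: big1 => q _; rewrite row0 ?mul0r.
  rewrite [RHS]mxE (bigD1 (s j)) //= big1 ?addr0 // => q qj.
  by rewrite (row0 j i) ?mulr0.
have entry : arc_image f i j (s i) (s j) = -1.
  have /andP[] := arc_image_offdiag i j fP sij.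
  have /andP[] := arc_image_offdiag j i fP sji.
  by move: prod1; nra.
apply/matrixP => p q; rewrite arc_mxE.
have [->|psi] := eqVneq p (s i); last by rewrite row0 ?mul0r.
rewrite mul1r; have [->|qi] := eqVneq q (s i).
  by rewrite diag1 // (negPf sij) subr0.
have [->|qj] := eqVneq q (s j); first by rewrite entry sub0r.
have rest : \sum_(r | (r != s i) && (r != s j)) - arc_image f i j (s i) r = 0.
  have := arc_image_sum i j (s i) fP.
  rewrite (bigD1 (s i)) //= (bigD1 (s j)) //= diag1 // entry addrA subrr add0r.
  by rewrite sumrN => ->; rewrite oppr0.
rewrite subrr; apply: oppr_inj; rewrite oppr0.
apply: (psumr_eq0P _ rest); last by rewrite qi.
move=> r /andP[ri _]; rewrite oppr_ge0; rewrite eq_sym in ri.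
by have /andP[] := arc_image_offdiag i j fP ri.
Qed.

(** Relabelling by [s] maps [arc_mx i j] to [arc_mx (s i) (s j)], and both [A]
and [f A] have the same coefficients on the corresponding arcs. *)
Lemma spectrum_preserver3 (R : realType) n (f : 'M[R]_n -> 'M[R]_n) :
  (3 <= n)%N -> spectrum_preserver f ->
  exists P : 'M[R]_n, is_perm_mx P /\
    forall A, RS A -> f A = P *m A *m invmx P.
Proof.
move=> n3 fP; have [s fs] := arc_image_arc n3 fP.
have [f_lin _ _] := fP; have f1 := preserver1 fP.
(* Row [i] of [perm_mx t *m A] is row [t i] of [A], hence the inverse. *)
exists (perm_mx s^-1); split=> [|A RSA]; first exact: perm_mx_is_perm.
have invP : invmx (perm_mx s^-1) = perm_mx s :> 'M[R]_n.
  have PQ : perm_mx s^-1 *m perm_mx s = 1%:M :> 'M[R]_n.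
    by rewrite -perm_mxM mulVg perm_mx1.
  have [uP _] := mulmx1_unit PQ.
  by rewrite -[LHS]mulmx1 -PQ mulmxA mulVmx // mul1mx.
have -> : perm_mx s^-1 *m A *m invmx (perm_mx s^-1) =
    \matrix_(k, l) A (s^-1%g k) (s^-1%g l).
  rewrite invP -row_permE -[s in X in _ *m X]invgK -col_permE.
  by apply/matrixP => k l; rewrite !mxE.
have idE : RS_linear (@id 'M[R]_n) by [].
have AE : A = 1%:M - \sum_i \sum_j A i j *: arc_mx R i j.
  exact: arc_image_expand idE erefl RSA.
have entry (B : 'I_n -> 'I_n -> 'M[R]_n) k l :
    (1%:M - \sum_i \sum_j A i j *: B i j) k l =
    (k == l)%:R - \sum_i \sum_j A i j * B i j k l.
  rewrite 3!mxE summxE; congr (_ - _); apply: eq_bigr => i _.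
  by rewrite summxE; apply: eq_bigr => j _; rewrite mxE.
rewrite (arc_image_expand f_lin f1 RSA); apply/matrixP => k l.
rewrite [RHS]mxE [in RHS]AE !entry (inj_eq perm_inj); congr (_ - _).
apply: eq_bigr => i _; apply: eq_bigr => j _; congr (_ * _).
have perm_eqE p q : (p == s q) = ((s^-1)%g p == q).
  by rewrite -{1}[p](permKV s) (inj_eq perm_inj).
by rewrite fs !arc_mxE !perm_eqE.
Qed.

(** * Dimension two *)

Lemma ord2P (P : 'I_2 -> Prop) : P 0 -> P 1 -> forall i, P i.
Proof.
move=> P0 P1 i; have : (i == 0) || (i == 1) by case: i => [[|[|]]].
by case/orP => /eqP ->.
Qed.

Lemma sum2E (V : zmodType) (F : 'I_2 -> V) : \sum_i F i = F 0 + F 1.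
Proof. by rewrite big_ord_recl big_ord1; congr (_ + F _); exact: val_inj. Qed.

(** In the coordinates [A 0 1] and [A 1 0], the doubly stochastic part carries
their sum and the other part their difference. *)
Lemma DS_plus_R2E (R : realType) (A : 'M[R]_2) (c : R) i j : RS A ->
  (DSpart A + c *: Rpart A) i j =
  (i == j)%:R - (A 0 1 + A 1 0) / 2 * ((i == j)%:R - (i != j)%:R)
  + c * (A 1 0 - A 0 1) / 2 * ((j == 0)%:R - (j == 1)%:R).
Proof.
move=> [_ A1]; have := A1 0; have := A1 1; rewrite !sum2E => r1 r0.
have A00 : A 0 0 = 1 - A 0 1 by rewrite -r0 addrK.
have A11 : A 1 1 = 1 - A 1 0 by rewrite -r1 addrAC subrr add0r.
have RvecE k : Rvec A k 0 = (A 1 0 - A 0 1) / 2 * ((k == 0)%:R - (k == 1)%:R).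
  rewrite mxE !sum2E A00 A11.
  by move: k; apply: ord2P; rewrite /= ?A00 ?A11; field.
have comb (B : 'M[R]_2) : (A - B + c *: B) i j = A i j - B i j + c * B i j.
  by rewrite !mxE.
rewrite /DSpart comb evec_mulE RvecE.
by move: i j {comb}; apply: ord2P; apply: ord2P; rewrite /= ?A00 ?A11; field.
Qed.

(** The constant is [c = 2 p - 1], where [p] is the upper left entry of the image
of the arc from [0] to [1]. The image of the opposite arc is then determined,
because the permutation matrix of the transposition must keep its zero
diagonal. *)
Lemma spectrum_preserver2 (R : realType) (f : 'M[R]_2 -> 'M[R]_2) :
  spectrum_preserver f -> exists c : R, -1 <= c <= 1 /\
    forall A, RS A -> f A = DSpart A + c *: Rpart A.
Proof.
move=> fP; have [f_lin fRS _] := fP; have f1 := preserver1 fP.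
pose M := arc_image f 0 1; pose M' := arc_image f 1 0.
have fE A : RS A -> f A = 1%:M - (A 0 1 *: M + A 1 0 *: M').
  move=> RSA; rewrite (arc_image_expand f_lin f1 RSA) !sum2E.
  by rewrite !arc_imageii // !scaler0 add0r addr0.
pose swap := fun_mx R (fun i : 'I_2 => if i == 0 then 1 else 0).
have RSswap : RS swap by exact: RS_fun_mx.
have swap0 i : f swap i i = 0.
  apply: RS_mxtrace0; first exact: fRS.
  by rewrite preserver_mxtrace // /mxtrace sum2E !mxE /= addr0.
have MM' i : M i i + M' i i = 1.
  have := swap0 i; rewrite fE // !mxE /= !mul1r eqxx => /eqP.
  by rewrite subr_eq0 eq_sym => /eqP.
have MD : M 0 0 + M 1 1 = 1.
  rewrite -(mxtrace_arc_image fP (isT : 0 != 1 :> 'I_2)).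
  by rewrite /mxtrace sum2E.
have Mrow k : M k 0 + M k 1 = 0 by rewrite -sum2E arc_image_sum.
have M'row k : M' k 0 + M' k 1 = 0 by rewrite -sum2E arc_image_sum.
have M0 := arc_image_diag_ge0 0 1 0 fP; have M1 := arc_image_diag_ge0 0 1 1 fP.
rewrite -/M in M0 M1.
exists (2 * M 0 0 - 1); split; first lra.
move=> A RSA; apply/matrixP => i j; rewrite fE // DS_plus_R2E //.
have := (MM' 0, MM' 1, Mrow 0, Mrow 1, M'row 0, M'row 1).
move=> [[[[[e1 e2] e3] e4] e5] e6].
have M01 : M 0 1 = - M 0 0 by lra.
have M11 : M 1 1 = 1 - M 0 0 by lra.
have M10 : M 1 0 = M 0 0 - 1 by lra.
have M'00 : M' 0 0 = 1 - M 0 0 by lra.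
have M'01 : M' 0 1 = M 0 0 - 1 by lra.
have M'11 : M' 1 1 = M 0 0 by lra.
have M'10 : M' 1 0 = - M 0 0 by lra.
have comb (a b : R) (B C : 'M[R]_2) :
    (1%:M - (a *: B + b *: C)) i j = (i == j)%:R - (a * B i j + b * C i j).
  by rewrite !mxE.
rewrite comb.
by move: i j {comb}; apply: ord2P; apply: ord2P;
  rewrite /= ?M01 ?M11 ?M10 ?M'00 ?M'01 ?M'11 ?M'10; field.
Qed.

(** One eigenvalue is [1], so the trace determines the other. *)
Lemma char_poly_RS2 (R : realType) (A : 'M[R]_2) : RS A ->
  char_poly A = 'X^2 - (\tr A)%:P * 'X + (\tr A - 1)%:P.
Proof.
move=> [_ A1]; have := A1 0; have := A1 1; rewrite !sum2E => r1 r0.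
have A01 : A 0 1 = 1 - A 0 0 by rewrite -r0 addrAC subrr add0r.
have A10 : A 1 0 = 1 - A 1 1 by rewrite -r1 addrK.
have det2 (B : 'M[{poly R}]_2) : \det B = B 0 0 * B 1 1 - B 0 1 * B 1 0.
  rewrite (expand_det_row _ 0) sum2E /cofactor !det_mx11 !mxE /=.
  rewrite expr0 expr1 mul1r mulN1r mulrN.
  by congr (_ * B _ _ - _ * B _ _); apply: val_inj.
rewrite /char_poly det2 !mxE /mxtrace sum2E /= A01 A10 !raddfB /= !raddfD /=.
ring.
Qed.

Lemma mxtrace_DS_plus_R2 (R : realType) (A : 'M[R]_2) (c : R) : RS A ->
  \tr (DSpart A + c *: Rpart A) = \tr A.
Proof.
move=> RSA; have [_ A1] := RSA; have := A1 0; have := A1 1; rewrite !sum2E => r1 r0.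
rewrite /mxtrace !sum2E !DS_plus_R2E //=.
have -> : A 0 1 = 1 - A 0 0 by rewrite -r0 addrAC subrr add0r.
have -> : A 1 0 = 1 - A 1 1 by rewrite -r1 addrK.
by field.
Qed.

(** * Spectrum preservers of row stochastic matrices *)

Theorem theorem4p4 (R : realType) (n : nat) (hn : (2 <= n)%N)
    (phi : @RS R n -> @RS R n) (phi_lin : linear_on_sets phi) :
  (forall A : @RS R n, spec (val (phi A)) = spec (val A)) <->
  ((n = 2%N /\ exists c : R, -1 <= c <= 1 /\
      forall A : @RS R n, val (phi A) = DSpart (val A) + c *: Rpart (val A)) \/
   ((3 <= n)%N /\ exists P : 'M[R]_n, is_perm_mx P /\
      forall A : @RS R n, val (phi A) = P *m val A *m invmx P)).
Proof.
have RSval (A : @RS R n) : RS (val A) := set_mem (valP A).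
split=> [phi_spec|].
  have [f f_lin f_phi] := linear_on_sets_RS phi_lin.
  have fP : spectrum_preserver f.
    split=> // A RSA; have -> : A = val (SigSub (mem_set RSA) : @RS R n) by [].
      by rewrite f_phi; exact: RSval.
    by rewrite f_phi; exact/spec_eq_char_poly/phi_spec.
  move: hn; rewrite leq_eqVlt => /orP[/eqP n2|n3]; [left|right].
    split=> //; subst n; have [c [c1 fE]] := spectrum_preserver2 fP.
    by exists c; split=> // A; rewrite -f_phi fE.
  split=> //; have [P [permP fE]] := spectrum_preserver3 n3 fP.
  by exists P; split=> // A; rewrite -f_phi fE.
move=> phiE A; apply/spec_eq_char_poly.
case: phiE => [[n2 [c [_ phiE]]]|[_ [P [/is_perm_mxP[s ->] phiE]]]].
  subst n; rewrite !char_poly_RS2; try exact: RSval.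
  by rewrite phiE mxtrace_DS_plus_R2.
rewrite phiE char_poly_similar // mulmxV //.
exact: unitmx_perm.
Qed.
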